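(* Let $n\ge 4$ and let $O\subseteq Q$ be an order ideal of the type $(D_n,n)$ staircase poset $Q$ described in the context. An $\oplus$-diagram $D$ of shape $O$ is a $\Gamma$-diagram if and only if: (1) whenever a box $z$ with $D(z)=0$ lies above (same column) a box containing $+$, all boxes of $O$ to the left of $z$ (same row) contain $0$; (2) whenever a box $z$ with $D(z)=0$, at distance $d$ from the diagonal, lies to the right of (in the same row as) a box $b$ with $D(b)=+$, there is no box containing $+$ that is strictly southwest of $b$ and lies exactly $d+1$ rows south of $z$; (3) there do not exist a box $c$ with $D(c)=0$ and three distinct boxes $b_1,b_2,b_3$ containing $+$ such that $c$ has distance $d$ from the diagonal and lies to the right of $b_1$ (same row), $b_2$ is the box in the column of $b_1$ exactly $d+1$ rows below $b_1$, and $b_3$ is strictly northwest of $b_2$ and strictly south of $b_1$.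
   Context: $W$: Weyl group of type $D_n$ with simple reflections $s_1,\dots,s_n$, where $s_is_{i+1}$ ($1\le i\le n-2$) and $s_{n-2}s_n$ have order 3 and all other pairs (in particular $s_{n-1},s_n$) commute; Bruhat order $<$. $Q$ is the set of boxes $(r,c)$ with $1\le r\le n-1$ (rows numbered top to bottom) and $1\le c\le n-r$; box $(r,c)$ is labeled $s_{r+c-1}$ if $r+c\le n-1$, while a diagonal box ($r+c=n$) is labeled $s_n$ if $n-r$ is odd and $s_{n-1}$ if $n-r$ is even. The order on $Q$ is the transitive closure of $(r,c)\lessdot(r,c+1)$ and $(r,c)\lessdot(r-1,c)$; order ideals are down-closed. The distance of box $(r,c)$ from the diagonal is the number of boxes of $Q$ below it in its column, namely $n-r-c$. Conventions: ''left/right'' means in the same row, ''above/below'' in the same column; compass directions need not be in the same row/column: $(r',c')$ is strictly south of $(r,c)$ if $r'>r$, strictly southwest if $r'>r$ and $c'<c$, strictly northwest if $r'<r$ and $c'<c$; ''$k$ rows south'' means row index larger by $k$. An $\oplus$-diagram of shape $O$ is a map $D:O\to\{0,+\}$. For a linear extension $b_1,\dots,b_m$ of $O$ set $s_{i_t}:=s_{b_{m+1-t}}$, $t_t=s_{i_t}$ if $D(b_{m+1-t})=0$ and $t_t=1$ otherwise, $v_{(0)}=1$, $v_{(k)}=t_1\cdots t_k$. $D$ is a $\Gamma$-diagram if $v_{(k-1)}<v_{(k-1)}s_{i_k}$ for all $k$ (independent of the linear extension). *)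

(* Defs.v *)
From mathcomp Require Import all_boot all_fingroup zify.

Set Implicit Arguments.
Unset Strict Implicit.
Unset Printing Implicit Defensive.

Import GroupScope.

(** * Length and Bruhat order of a group with respect to a generating set *)

(* [S ^+ k] is the set of products of [k] elements of [S]. *)
Lemma word_exists (gT : finGroupType) (S : {set gT}) (w : gT) :
  exists k, (w \in <<S>>) ==> (w \in S ^+ k).
Proof.
case: (boolP (w \in <<S>>)) => [/gen_prodgP[k [c Sc ->]]|_]; last by exists 0.
exists k; elim: k c Sc => [|k IHk] c Sc; first by rewrite big_ord0 expg0 set11.
rewrite big_ord_recr expgSr mem_mulg ?Sc //.
exact: (IHk (fun i => c (widen_ord (leqnSn k) i))).
Qed.

(* Elements outside [<<S>>] get the junk value 0. *)
Definition wlength (gT : finGroupType) (S : {set gT}) (w : gT) : nat :=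
  ex_minn (word_exists S w).

Definition reflections (gT : finGroupType) (S : {set gT}) : {set gT} :=
  class_support S <<S>>.

Definition bruhat_arrow (gT : finGroupType) (S : {set gT}) : rel gT :=
  [rel u w | [exists t in reflections S, w == u * t]
             && (wlength S u < wlength S w)%N].

Definition bruhat_lt (gT : finGroupType) (S : {set gT}) (u w : gT) : bool :=
  (u != w) && connect (bruhat_arrow S) u w.

(** * The Weyl group of type D_n *)

(* [(i, false)] and [(i, true)] stand for the vectors e_(i+1) and - e_(i+1);
   Weyl group elements are identified with their action on these 2n vectors. *)
Definition signed (n : nat) : finType := ('I_n * bool)%type.

(* Reflection in the root e_i - e_j if [eps = false], e_i + e_j if
   [eps = true] (for i <> j). *)
Definition root_refl (n : nat) (i j : 'I_n) (eps : bool) : {perm signed n} :=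
  tperm ((i, false) : signed n) ((j, eps) : signed n)
  * tperm ((i, true) : signed n) ((j, ~~ eps) : signed n).

(* [simple k] is s_(k+1), for the simple roots e_i - e_(i+1) (1 <= i <= n-1)
   and e_(n-1) + e_n.  MathComp composes permutations from left to right;
   inversion fixes every [simple k], so neither the Coxeter system nor the
   Bruhat order depends on this convention. *)
Definition simple (n : nat) (k : 'I_n) : {perm signed n} :=
  if (k.+1 < n)%N then root_refl k (ordS k) false
  else root_refl (ord_pred k) k true.

Definition simples (n : nat) : {set {perm signed n}} :=
  [set simple k | k : 'I_n].

Definition weyl_lt (n : nat) (u w : {perm signed n}) : bool :=
  bruhat_lt (simples n) u w.

(** * The staircase poset *)

(* Rows and columns are numbered from 1, so index 0 is never used by a box of
   [staircase n]. *)
Definition box (n : nat) : finType := ('I_n * 'I_n)%type.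

Definition row (n : nat) (b : box n) : nat := b.1.
Definition col (n : nat) (b : box n) : nat := b.2.

Definition staircase (n : nat) : {set box n} :=
  [set b : box n | [&& 0 < row b, 0 < col b & row b + col b <= n]%N].

Definition box_cover (n : nat) : rel (box n) :=
  [rel x y | [&& x \in staircase n, y \in staircase n
    & ((row y == row x) && (col y == (col x).+1))
      || ((row x == (row y).+1) && (col y == col x))]].

Definition box_le (n : nat) : rel (box n) := connect (@box_cover n).

Definition order_ideal (n : nat) (O : {set box n}) : Prop :=
  O \subset staircase n /\
  forall x y : box n, y \in O -> box_le x y -> x \in O.

Definition diag_dist (n : nat) (b : box n) : nat := (n - row b - col b)%N.

(* Off by one with respect to the usual numbering, like [simple]: [k] stands
   for s_(k+1). *)
Definition label_index (n : nat) (b : box n) : nat :=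
  if (row b + col b < n)%N then (row b + col b - 2)%N
  else if odd (n - row b) then (n - 1)%N else (n - 2)%N.

Lemma label_index_lt (n : nat) (b : box n) : (label_index b < n)%N.
Proof.
rewrite /label_index; have := ltn_ord b.1; case: ifP; first by lia.
by case: ifP; lia.
Qed.

Definition box_refl (n : nat) (b : box n) : {perm signed n} :=
  simple (Ordinal (label_index_lt b)).

(** * Diagrams *)

Inductive entry : Type := Zero | Plus.

Notation cells O := {b | b \in O}.

Definition diagram (n : nat) (O : {set box n}) : Type := cells O -> entry.

(* The list [e] is b_1, ..., b_m. *)
Definition linear_extension (n : nat) (O : {set box n}) (e : seq (cells O)) :
    Prop :=
  [/\ uniq e, forall x : cells O, x \in e
    & forall x y : cells O,
        box_le (val x) (val y) -> (index x e <= index y e)%N].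

(* The product t_1 ... t_k, where [p] is the list b_m, ..., b_(m+1-k). *)
Definition partial_product (n : nat) (O : {set box n}) (D : diagram O)
    (p : seq (cells O)) : {perm signed n} :=
  \prod_(b <- p) (if D b is Zero then box_refl (val b) else 1).

(* A decomposition [rev e = p ++ b :: q] with [size p = k - 1] gives
   [partial_product D p] = v_(k-1) and [box_refl (val b)] = s_(i_k). *)
Definition Gamma_diagram (n : nat) (O : {set box n}) (e : seq (cells O))
    (D : diagram O) : Prop :=
  forall (p q : seq (cells O)) (b : cells O),
    rev e = p ++ b :: q ->
    weyl_lt (partial_product D p) (partial_product D p * box_refl (val b)).

Definition left_of (n : nat) (x y : box n) : Prop :=
  row x = row y /\ (col x < col y)%N.

Definition above (n : nat) (x y : box n) : Prop :=
  col x = col y /\ (row x < row y)%N.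

Definition strictly_south (n : nat) (x y : box n) : Prop :=
  (row y < row x)%N.

Definition strictly_southwest (n : nat) (x y : box n) : Prop :=
  (row y < row x)%N /\ (col x < col y)%N.

Definition strictly_northwest (n : nat) (x y : box n) : Prop :=
  (row x < row y)%N /\ (col x < col y)%N.

Definition rows_south (n : nat) (k : nat) (x y : box n) : Prop :=
  row x = (row y + k)%N.

Definition condition1 (n : nat) (O : {set box n}) (D : diagram O) : Prop :=
  forall z : cells O, D z = Zero ->
    (exists2 b : cells O, D b = Plus & above (val z) (val b)) ->
    forall y : cells O, left_of (val y) (val z) -> D y = Zero.

Definition condition2 (n : nat) (O : {set box n}) (D : diagram O) : Prop :=
  forall z b : cells O, D z = Zero -> D b = Plus ->
    left_of (val b) (val z) ->
    ~ exists x : cells O,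
        [/\ D x = Plus, strictly_southwest (val x) (val b)
          & rows_south (diag_dist (val z)).+1 (val x) (val z)].

Definition condition3 (n : nat) (O : {set box n}) (D : diagram O) : Prop :=
  ~ exists c b1 b2 b3 : cells O,
      [/\ [/\ D c = Zero, D b1 = Plus, D b2 = Plus & D b3 = Plus],
          [/\ b1 <> b2, b1 <> b3 & b2 <> b3],
          left_of (val b1) (val c),
          col (val b2) = col (val b1)
            /\ rows_south (diag_dist (val c)).+1 (val b2) (val b1)
        & strictly_northwest (val b3) (val b2)
            /\ strictly_south (val b3) (val b1)].

(* Main.v *)
From mathcomp Require Import all_boot all_fingroup.
From mathcomp Require Import order ssralg ssrnum ssrint zify.
Require Import Defs.

(** Read a diagram as a system of wires entering from the top and from the
    right: wires cross at a [0] and bounce off each other at a [+].  A wire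
    leaving the diagonal box of a row downwards reenters the next row from the
    right with the opposite sign.  Giving the vector [e_i] the height [n - i],
    the Gamma condition at a box says that the vertical wire entering it is
    higher than the horizontal one.  Hence a row is admissible iff, in the
    sequence of its incoming column values followed by the reentering value
    [z], the columns of its pluses and [z] are strict left-to-right minima.

    A column [c] stops being a left-to-right minimum, forever, at the first
    row where it has a [0] with a [+] on its left; this gives condition (1).
    Since column values only decrease, [z] is always minimal iff all sums of
    two column values stay positive.  If row [n + 1 - c] has a plus, the value
    at its first plus leaves the diagram and the opposite of the last value [f]
    of column [c] enters, so the sums stay positive iff the values of all other
    columns exceed [f].  If [c] is no longer a left-to-right minimum, this means
    that exactly one column lies below [f] and that it holds the only plus
    of the row, which is what (2) and (3) express. *)

Set Implicit Arguments.
Unset Strict Implicit.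
Unset Printing Implicit Defensive.

Import Order.TTheory GRing.Theory Num.Theory.

(** * Wires in the staircase *)

Section Wires.
Variables (n : nat) (p : nat -> nat -> bool).
Local Open Scope ring_scope.

(* The horizontal value entering column [m - k] of a row with [m] boxes, plus
   set [P] and incoming column values [x]; [x m.+1] is the value that left the
   diagonal box of the previous row downwards. *)
Fixpoint carry (P : nat -> bool) (x : nat -> int) (m k : nat) : int :=
  if k is k'.+1 then
    if P (m - k')%N then x (m - k')%N else carry P x m k'
  else - x m.+1.

(* [vert r c] leaves box [(r, c)] downwards, [horiz r c] enters it from the
   right. *)
Fixpoint vert (r : nat) : nat -> int :=
  if r is r'.+1 then
    fun c => if p r c then carry (p r) (vert r') (n - r) (n - r - c) else vert r' c
  else fun c => n%:Z - c%:Z.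

Definition horiz (r c : nat) : int :=
  carry (p r) (vert r.-1) (n - r) (n - r - c).

Lemma vertS r c : vert r.+1 c = if p r.+1 c then horiz r.+1 c else vert r c.
Proof. by []. Qed.

Lemma horiz_diag r c : (0 < r)%N -> (r + c)%N = n -> horiz r c = - vert r.-1 c.+1.
Proof.
move=> r0 e; rewrite /horiz; have -> : (n - r - c = 0)%N by lia.
by rewrite /=; congr (- vert _ _); lia.
Qed.

Lemma horizE r c : (r + c < n)%N ->
  horiz r c = if p r c.+1 then vert r.-1 c.+1 else horiz r c.+1.
Proof.
move=> h; rewrite /horiz.
have -> : (n - r - c = (n - r - c.+1).+1)%N by lia.
by rewrite /=; have -> : (n - r - (n - r - c.+1) = c.+1)%N by lia.
Qed.

Lemma horizP r c : (0 < r)%N -> (r + c <= n)%N ->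
  (horiz r c = - vert r.-1 (n - r).+1
     /\ forall d, (c < d <= n - r)%N -> p r d = false)
  \/ exists d, [/\ (c < d <= n - r)%N, p r d, horiz r c = vert r.-1 d
       & forall i, (c < i < d)%N -> p r i = false].
Proof.
move=> r0; move: {2}(n - r - c)%N (leqnn (n - r - c)) => k.
elim: k c => [|k IHk] c hk hc.
  left; rewrite horiz_diag //; last by lia.
  by split=> [|d]; [congr (- vert _ _); lia | lia].
have [e|hlt] : (r + c)%N = n \/ (r + c < n)%N by lia.
  by apply: IHk; lia.
rewrite horizE //; case: ifP => pc.
  by right; exists c.+1; split=> //; [lia | move=> i; lia].
have [||[-> H]|[d [hd pd -> H]]] := IHk c.+1; [lia | lia | left | right].
  split=> // d hd; have [->//|hd'] : d = c.+1 \/ (c.+1 < d)%N by lia.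
  by apply: H; lia.
exists d; split=> //; first by lia.
move=> i hi; have [->//|hd'] : i = c.+1 \/ (c.+1 < i)%N by lia.
by apply: H; lia.
Qed.

Definition row_ok (r : nat) : Prop :=
  forall c, (0 < c)%N -> (r + c <= n)%N -> horiz r c < vert r.-1 c.

Lemma vertE r c : (0 < r)%N -> vert r c = if p r c then horiz r c else vert r.-1 c.
Proof. by case: r. Qed.

(** From right to left, the horizontal wire changes only at a plus, where admissibility makes the
    new value the larger one. *)
Lemma horiz_antitone r c d : row_ok r -> (c <= d)%N -> (r + d <= n)%N ->
  horiz r d <= horiz r c.
Proof.
move=> okr; elim: d => [|d IHd] hcd hd; first by have -> : c = 0%N by lia.
have [->//|hlt] : c = d.+1 \/ (c <= d)%N by lia.
have := IHd hlt; rewrite (@horizE r d); last by lia.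
have := @okr d.+1 isT hd; case: ifP; lia.
Qed.

Lemma horiz_before_plus r d : (0 < d)%N -> (r + d <= n)%N -> p r d ->
  horiz r d.-1 = vert r.-1 d.
Proof.
by move=> d0 hd pd; rewrite horizE; [rewrite prednK // pd | lia].
Qed.

Lemma vert_decr r c : (0 < r)%N -> row_ok r -> (0 < c)%N -> (r + c <= n)%N ->
  vert r c <= vert r.-1 c.
Proof.
by move=> r0 okr c0 hc; rewrite vertE //; have := okr c c0 hc; case: ifP; lia.
Qed.

Lemma wrap_lt r c : (0 < r)%N -> row_ok r -> (0 < c)%N -> (r + c <= n)%N ->
  - vert r.-1 (n - r).+1 < vert r.-1 c.
Proof.
move=> r0 okr c0 hc; rewrite -horiz_diag //; last by lia.
have := okr c c0 hc; have := @horiz_antitone r c (n - r) okr; lia.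
Qed.

Lemma plus_record r c d : row_ok r -> (0 < c < d)%N -> (r + d <= n)%N -> p r d ->
  vert r.-1 d < vert r.-1 c.
Proof.
move=> okr hcd hd pd; have := @okr c; have := @horiz_antitone r c d.-1 okr.
rewrite horiz_before_plus //; lia.
Qed.

(** Zeros let the horizontal wire pass, so what leaves column [c] leftwards lands in the last plus
    before it. Here [c] may be one past the end of the row, which covers the reentering wire. *)
Lemma last_plus_before r c c' : (0 < c' < c)%N -> p r c' -> (r + c <= n.+1)%N ->
  exists j, [/\ (c' <= j < c)%N, p r j, horiz r j = horiz r c.-1
       & forall i, (j < i < c)%N -> p r i = false].
Proof.
move=> + pc'; elim: c => [|c IHc] //= hc hn; first by lia.
case pc: (p r c); first by exists c; split=> // [|i]; lia.
have [e|h] : c = c' \/ (0 < c' < c)%N by lia.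
  by move: pc; rewrite e pc'.
have [|j [hj pj ej Hj]] := IHc h; first by lia.
exists j; split=> //; first by lia.
  by rewrite ej horizE; [rewrite prednK ?pc //; lia | lia].
move=> i hi; have [->//|h'] : i = c \/ (j < i < c)%N by lia.
exact: Hj.
Qed.

(** Column [j] receives the value of column [c] if [c] has a plus, and otherwise a horizontal value
    that admissibility puts below it. *)
Lemma plus_lowers r c c' : (0 < r)%N -> row_ok r -> (0 < c' < c)%N -> p r c' ->
  (r + c <= n)%N ->
  exists j, [/\ (c' <= j < c)%N, p r j, vert r j <= vert r.-1 c,
      (p r c = false -> vert r j < vert r.-1 c)
       & forall i, (j < i < c)%N -> p r i = false].
Proof.
move=> r0 okr hc pc' hn.
have [|j [hj pj ej Hj]] := last_plus_before hc pc'; first by lia.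
have e : horiz r c.-1 = if p r c then vert r.-1 c else horiz r c.
  by rewrite horizE; [rewrite prednK //; lia | lia].
have := okr c; exists j; split=> //; rewrite vertE // pj ej e; case: ifP; lia.
Qed.

Definition cond1 : Prop :=
  forall r c r2 c', (0 < r)%N -> p r c = false -> (r < r2)%N -> (r2 + c <= n)%N ->
    p r2 c -> (0 < c' < c)%N -> p r c' = false.

(** Row [n.+1 - c] is the one [d + 1] rows below a box of column [c] at distance [d]: the row just
    under that column, where the opposite of its last value reenters. *)
Definition cond2 : Prop :=
  forall r c c' c2, (0 < r)%N -> (r + c <= n)%N -> p r c = false -> (0 < c' < c)%N ->
    p r c' -> (0 < c2 < c')%N -> p (n.+1 - c)%N c2 = false.

Definition cond3 : Prop :=
  forall r c c1 r3 c3, (0 < r)%N -> (r + c <= n)%N -> p r c = false -> (0 < c1 < c)%N ->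
    p r c1 -> p (n.+1 - c)%N c1 -> (r < r3 < n.+1 - c)%N -> (0 < c3 < c1)%N ->
    p r3 c3 = false.

(** * Admissible rows force the three conditions *)

Section Necessity.
Hypothesis ok : forall r, (0 < r < n)%N -> row_ok r.

Lemma vert_antitone r r' c : (0 < c)%N -> (r <= r')%N -> (r' + c <= n)%N ->
  vert r' c <= vert r c.
Proof.
move=> c0; elim: r' => [|r' IH] hr hn; first by have -> : r = 0%N by lia.
have [->//|hlt] : r = r'.+1 \/ (r <= r')%N by lia.
have okr : row_ok r'.+1 by apply: ok; lia.
have := IH hlt; have := @vert_decr r'.+1 c isT okr c0 hn; rewrite /=; lia.
Qed.

(** Row [n - j + 1] takes in the opposite of the last value of column [j], which must lie below
    column [i]. Both columns were only higher in earlier rows. *)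
Lemma pair_sum r i j : (0 < i < j)%N -> (r + j <= n)%N -> 0 < vert r i + vert r j.
Proof.
move=> hij hn.
have h1 : vert (n - j) i <= vert r i by apply: vert_antitone; lia.
have h2 : vert (n - j) j <= vert r j by apply: vert_antitone; lia.
have okr : row_ok (n - j).+1 by apply: ok; lia.
have := @wrap_lt (n - j).+1 i isT okr; rewrite /=.
have -> : (n - (n - j).+1).+1 = j by lia.
lia.
Qed.

Lemma pair_sum_neq r i j : (0 < i)%N -> (0 < j)%N -> i != j ->
  (r + i <= n)%N -> (r + j <= n)%N -> 0 < vert r i + vert r j.
Proof.
move=> hi hj ne h1 h2; have [h|h] : (i < j)%N \/ (j < i)%N by lia.
  by apply: pair_sum; lia.
by rewrite addrC; apply: pair_sum; lia.
Qed.

(** A later plus in column [c] would require [c] to be lower than column [j], but [j] has only gone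
    down while [c] stayed fixed. *)
Lemma killed_persists r r' j c : (0 < j < c)%N -> vert r j < vert r c ->
  (r <= r')%N -> (r' + c <= n)%N ->
  vert r' c = vert r c /\ (forall s, (r < s <= r')%N -> p s c = false).
Proof.
move=> hj hlt; elim: r' => [|r' IH] hr hn.
  by have -> : r = 0%N; [lia | split=> // s; lia].
have [->//|hr'] : r = r'.+1 \/ (r <= r')%N by lia.
  by split=> // s; lia.
have [||e H] := IH; [lia | lia |].
case pc: (p r'.+1 c).
  have okr : row_ok r'.+1 by apply: ok; lia.
  have := @plus_record r'.+1 j c okr hj hn pc; rewrite /= e.
  have := @vert_antitone r r' j; lia.
rewrite vertS pc e; split=> // s hs.
have [->//|h] : s = r'.+1 \/ (r < s <= r')%N by lia.
exact: H.
Qed.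

Lemma killed_lt r r' j c : (0 < j < c)%N -> vert r j < vert r c ->
  (r <= r')%N -> (r' + c <= n)%N -> vert r' j < vert r' c.
Proof.
move=> hj hlt hr hn; have [-> _] := killed_persists hj hlt hr hn.
have := @vert_antitone r r' j; lia.
Qed.

Lemma zero_after_plus r c c' : (0 < r)%N -> (r + c <= n)%N -> p r c = false ->
  (0 < c' < c)%N -> p r c' -> exists2 j, (c' <= j < c)%N & vert r j < vert r c.
Proof.
move=> r0 hn pc hc pc'.
have okr : row_ok r by apply: ok; lia.
have [j [hj pj _ H _]] := plus_lowers r0 okr hc pc' hn.
by exists j => //; rewrite (vertE c r0) pc; apply: H.
Qed.

(* Row [n + 1 - c] inserts [- vert (n - c) c] at its last plus; a small value
   surviving in another column would break [pair_sum]. *)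
Lemma no_small_survivor c j q : (0 < j < c)%N -> (c <= n)%N ->
  vert (n - c) j < vert (n - c) c -> (0 < q < c)%N -> p (n.+1 - c) q ->
  (p (n.+1 - c) j -> (q < j)%N) -> False.
Proof.
move=> hj hcn hlt hq; have -> : (n.+1 - c = (n - c).+1)%N by lia.
set R := (n - c)%N in hlt * => pq hjq.
have hR : (0 < R.+1 < n)%N by lia.
have okR := ok hR.
have [|m [hm pm em Hm]] := @last_plus_before R.+1 c q hq pq; first by lia.
have em2 : vert R.+1 m = - vert R c.
  rewrite vertS pm em horiz_diag //; last by lia.
  by congr (- vert _ _); lia.
(* Without a plus at [j] the small value stays there, and its sum with the value of column [m] is
   negative. With one, it moves to the last plus [i] before [j], which exists since [q < j]. *)
case pj: (p R.+1 j); last first.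
  have := @pair_sum_neq R.+1 m j; rewrite em2 [vert R.+1 j]vertS pj.
  have : m != j by apply: contraFneq pj => <-.
  lia.
have hqj : (0 < q < j)%N by have := hjq pj; lia.
have [|i [hi pi ei _]] := @last_plus_before R.+1 j q hqj pq; first by lia.
have hjm : (j <= m)%N.
  by rewrite leqNgt; apply/negP => h; move: (Hm j); rewrite pj; lia.
have := @pair_sum_neq R.+1 m i.
rewrite em2 [vert R.+1 i]vertS pi ei horiz_before_plus //=; lia.
Qed.

Lemma ok_cond1 : cond1.
Proof.
move=> r c r2 c' r0 pc hr hn pc2 hc'; apply/negP => pc'.
have [|j hj hlt] := zero_after_plus r0 _ pc hc' pc'; first by lia.
have hj' : (0 < j < c)%N by lia.
have [_ H] := killed_persists hj' hlt (ltnW hr) hn.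
by move: (H r2); rewrite pc2; lia.
Qed.

Lemma ok_cond2 : cond2.
Proof.
move=> r c c' c2 r0 hn pc hc' pc' hc2; apply/negP => pc2.
have [j hj hlt] := zero_after_plus r0 hn pc hc' pc'.
apply: (@no_small_survivor c j c2) => //; try lia.
by apply: killed_lt hlt _ _; lia.
Qed.

Lemma ok_cond3 : cond3.
Proof.
move=> r c c1 r3 c3 r0 hn pc hc1 pc1 pc1' hr3 hc3; apply/negP => pc3.
have [j hj hlt] := zero_after_plus r0 hn pc hc1 pc1.
have hltR : vert (n - c) j < vert (n - c) c by apply: killed_lt hlt _ _; lia.
(* If [j = c1], the plus at [(r3, c3)] yields a second column [i < c1] below column [c]. The value
   of [c1] survives if [i] has a plus in row [n.+1 - c], and the value of [i] survives otherwise. *)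
have [e|ne] : j = c1 \/ (c1 < j)%N by lia.
  subst j.
  have okr3 : row_ok r3 by apply: ok; lia.
  have [||i [hi pi hle _ _]] := plus_lowers _ okr3 hc3 pc3; [lia | lia |].
  have [||ec _] := @killed_persists r r3 c1 c hc1 hlt; [lia | lia |].
  have hlt3 : vert r3 i < vert r3 c.
    have := @vert_antitone r r3.-1 c1; lia.
  have hltR' : vert (n - c) i < vert (n - c) c by apply: killed_lt hlt3 _ _; lia.
  case pi': (p (n.+1 - c) i).
    by apply: (@no_small_survivor c c1 i) => //; lia.
  by apply: (@no_small_survivor c i c1) => //; rewrite ?pi' //; lia.
by apply: (@no_small_survivor c j c1) => //; lia.
Qed.

End Necessity.

(** * The three conditions force admissible rows *)

Section Sufficiency.
Hypotheses (h1 : cond1) (h2 : cond2) (h3 : cond3).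

(** Invariant of the induction on rows. If column [c] is not a left-to-right minimum, row [r0]
    witnesses a zero passed by its last plus [j] on the left; then either every other column left of
    [c] is above [c], or a plus [(r3, c3)] is recorded for use with condition (3). *)
Definition column_state (r c : nat) : Prop :=
  (forall i, (0 < i < c)%N -> vert r c < vert r i)
  \/ exists r0 j, [/\ (0 < r0 <= r)%N /\ (0 < j < c)%N, p r0 c = false, p r0 j,
       forall i, (j < i < c)%N -> p r0 i = false
     & (forall i, (0 < i < c)%N -> i != j -> vert r c < vert r i)
       \/ exists r3 c3, [/\ (r0 < r3 <= r)%N, (0 < c3 < j)%N & p r3 c3]].

Definition pairs_pos (r : nat) : Prop :=
  forall i j, (0 < i < j)%N -> (r + j <= n)%N -> 0 < vert r i + vert r j.

Definition columns_ok (r : nat) : Prop :=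
  forall c, (0 < c)%N -> (r + c <= n)%N -> column_state r c.

Lemma row_ok_next r : (r.+1 < n)%N -> pairs_pos r -> columns_ok r -> row_ok r.+1.
Proof.
move=> hr hp hc c c0 hn.
have [[-> _]|[d [hd pd -> _]]] := @horizP r.+1 c isT hn; rewrite /=.
  have := hp c (n - r.+1).+1; lia.
(* The wire comes from a plus in column [d], which must be a left-to-right minimum by condition
   (1). *)
have [||H|[r0 [j [[hr0 hj] pd0 pj _ _]]]] := hc d; [lia | lia | by apply: H; lia |].
by move: pj; rewrite (@h1 r0 d r.+1 j) //; lia.
Qed.

Lemma columns_ok_next r : (r.+1 < n)%N -> columns_ok r -> row_ok r.+1 ->
  columns_ok r.+1.
Proof.
move=> hr hc okr c c0 hn.
have [||H|[r0 [j [[hr0 hj] pc0 pj Hj HB]]]] := hc c; [lia | lia | |].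
  case pc: (p r.+1 c).
    left=> i hi; rewrite !vertS pc; have := okr c c0 hn; rewrite /= => hlt.
    case: ifP => _; last by have := H i hi; lia.
    have := @horiz_antitone r.+1 i c.-1 okr; rewrite horiz_before_plus //=; lia.
  (* A minimum with a zero: if there is a plus on its left, [r.+1] becomes the witness row. Columns
     of pluses before the last one [j] receive at least the old value of [j], hence stay above
     [c]. *)
  case: (boolP (has (p r.+1) (iota 1 c.-1))) => [/hasP[c']|/hasPn Hn].
    rewrite mem_iota => hc' pc'; right; exists r.+1.
    have hc2 : (0 < c' < c)%N by lia.
    have [j [hj pj _ hlt Hj]] := plus_lowers (ltn0Sn r) okr hc2 pc' hn.
    exists j; split=> //; first by lia.
    left=> i hi ne; rewrite [vert r.+1 c]vertS pc vertS; case: ifP => pi; last exact: H.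
    have hij : (i < j)%N.
      by rewrite ltnNge; apply/negP => h; move: (Hj i); rewrite pi; lia.
    have := @horiz_antitone r.+1 i j.-1 okr; rewrite horiz_before_plus //=; try lia.
    have := H j; lia.
  left=> i hi; rewrite !vertS pc (negbTE (Hn i _)) ?mem_iota; last by lia.
  exact: H.
right; exists r0, j; split=> //; first by lia.
case: HB => [HB|[r3 [c3 [hr3 hc3 pc3]]]]; last by right; exists r3, c3; split=> //; lia.
(* These columns have zeros right of the plus [j] in row [r0], so condition (1) bars them from later
   pluses. *)
have dead i : (j < i <= c)%N -> p r.+1 i = false.
  move=> hi; apply/negP => pi.
  have pi0 : p r0 i = false by (have [->//|h] : i = c \/ (j < i < c)%N by lia); apply: Hj.
  by move: pj; rewrite (@h1 r0 i r.+1 j) //; lia.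
case: (boolP (has (p r.+1) (iota 1 j.-1))) => [/hasP[c3]|/hasPn Hn].
  by rewrite mem_iota => hc3 pc3; right; exists r.+1, c3; split=> //; lia.
left=> i hi ne; rewrite !vertS dead; last by lia.
have -> : p r.+1 i = false; last exact: HB.
have [h|h] : (j < i)%N \/ (i < j)%N by lia.
  by apply: dead; lia.
by apply: negbTE; apply: Hn; rewrite mem_iota; lia.
Qed.

(** The row permutes the values of its columns, except that the value at its first plus leaves and
    the opposite of [vert r (n - r)] enters. Only sums with the new value need care; the other
    summand is some [vert r k] that does not leave. *)
Lemma pairs_pos_shift r : (r.+1 < n)%N -> pairs_pos r -> 
  (forall k, (0 < k < n - r)%N ->
     p r.+1 k = false \/ (exists2 i, (0 < i < k)%N & p r.+1 i) ->
     (exists2 i, (0 < i < n - r)%N & p r.+1 i) ->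
     vert r (n - r)%N < vert r k) ->
  pairs_pos r.+1.
Proof.
move=> hr hp H i j hij hn.
have hp' a b : (0 < a)%N -> (0 < b)%N -> a != b -> (a <= n - r)%N -> (b <= n - r)%N ->
    0 < vert r a + vert r b.
  move=> *; have [h|h] : (a < b)%N \/ (b < a)%N by lia.
    by apply: hp; lia.
  by rewrite addrC; apply: hp; lia.
have e : (n - r.+1).+1 = (n - r)%N by lia.
rewrite !vertS; case pi: (p r.+1 i); case pj: (p r.+1 j).
- have [|[_ F]|[d [hd pd -> Hd]]] := @horizP r.+1 i isT; first by lia.
    by move: (F j); rewrite pj; lia.
  have hdj : (d <= j)%N by rewrite leqNgt; apply/negP => h; move: (Hd j); rewrite pj; lia.
  have [|[-> _]|[d' [hd' pd' -> _]]] := @horizP r.+1 j isT; [lia | |].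
    rewrite /= e; have := H d; rewrite subr_gt0; apply; first by lia.
      by right; exists i => //; lia.
    by exists i => //; lia.
  by apply: hp'; lia.
- have [|[-> _]|[d [hd pd -> Hd]]] := @horizP r.+1 i isT; [lia | |].
    rewrite /= e; have := H j; rewrite addrC subr_gt0; apply; first by lia.
      by left.
    by exists i => //; lia.
  apply: hp'; try lia.
  by apply: contraFneq pj => <-.
- have [|[-> _]|[d [hd pd -> Hd]]] := @horizP r.+1 j isT; [lia | |].
    rewrite /= e; have := H i; rewrite subr_gt0; apply; first by lia.
      by left.
    by exists j => //; lia.
  by apply: hp'; lia.
- by apply: hp'; lia.
Qed.

Lemma pairs_pos_next r : (r.+1 < n)%N -> pairs_pos r -> columns_ok r ->
  pairs_pos r.+1.
Proof.
move=> hr hp hc; apply: pairs_pos_shift => // k hk hmin [i hi pi].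
have e : r.+1 = (n.+1 - (n - r))%N by lia.
have [||H|[r0 [j [[hr0 hj] pc0 pj Hj HB]]]] := hc (n - r)%N; [lia | lia | exact: H |].
(* Condition (2) excludes pluses left of [j] in this row, condition (1) those between [j] and
   [n - r]. *)
have only i' : (0 < i' < n - r)%N -> p r.+1 i' -> i' = j.
  move=> hi' pi'; have [h|[h|//]] : (i' < j)%N \/ (j < i')%N \/ i' = j by lia.
    by move: pi'; rewrite e (@h2 r0 (n - r)%N j) //; lia.
  by move: pj; rewrite (@h1 r0 i' r.+1 j) //; (try apply: Hj); lia.
have pj' : p r.+1 j by rewrite -(only i).
(* The value of column [j] leaves the diagram here, so [k] differs from [j]; a recorded plus
   contradicts condition (3). *)
case: HB => [HB|[r3 [c3 [hr3 hc3 pc3]]]].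
  apply: HB => //; case: hmin => [h|[i' hi' pi']].
    by apply: contraFneq h => ->.
  rewrite -(only i') //; lia.
by move: pc3; rewrite (@h3 r0 (n - r)%N j r3 c3) // -?e //; lia.
Qed.

Lemma conds_ok r : (0 < r < n)%N -> row_ok r.
Proof.
have inv s : (s < n)%N -> pairs_pos s /\ columns_ok s.
  elim: s => [|s IHs] hs; last first.
    have [|hp hc] := IHs; first by lia.
    split; first exact: pairs_pos_next.
    by apply: columns_ok_next => //; apply: row_ok_next.
  by split=> [i j|c c0 hn] /=; [lia | left=> i /=; lia].
case: r => [//|r] hr; have [|hp hc] := inv r; first by lia.
by apply: row_ok_next => //; lia.
Qed.

End Sufficiency.

Lemma row_ok_conds :
  (forall r, (0 < r < n)%N -> row_ok r) <-> [/\ cond1, cond2 & cond3].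
Proof.
split=> [ok|[h1 h2 h3]]; last exact: conds_ok.
by split; [apply: ok_cond1 | apply: ok_cond2 | apply: ok_cond3].
Qed.

End Wires.

Import GroupScope.

(** * Length in type D *)

Section Length.
Variables (gT : finGroupType) (S : {set gT}).

Lemma wlength_word (w : gT) : w \in <<S>> -> w \in S ^+ wlength S w.
Proof. by rewrite /wlength => Sw; case: ex_minnP => m /implyP/(_ Sw). Qed.

Lemma wlength_min (w : gT) k : w \in S ^+ k -> (wlength S w <= k)%N.
Proof. by rewrite /wlength => Sw; case: ex_minnP => m _; apply; rewrite Sw implybT. Qed.

Lemma connect_bruhat_length (u w : gT) : connect (bruhat_arrow S) u w ->
  u != w -> (wlength S u < wlength S w)%N.
Proof.
case/connectP => q; elim: q u => [|v q IHq] u /=; first by move=> _ ->; rewrite eqxx.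
case/andP => /andP[_ lt_uv] qv ew _.
have [<-//|ne] := eqVneq v w.
exact: ltn_trans lt_uv (IHq v qv ew ne).
Qed.

(** Length increases along every chain, and [s] is itself a reflection, so one arrow suffices. *)
Lemma bruhat_lt_simple (v s : gT) : s \in S ->
  bruhat_lt S v (v * s) = (wlength S v < wlength S (v * s))%N.
Proof.
move=> Ss; apply/andP/idP => [[ne]|lt_vs].
  by move=> /connect_bruhat_length; apply.
split; first by apply: contraTneq lt_vs => <-; rewrite ltnn.
apply/connect1/andP; split=> //; apply/existsP; exists s; rewrite eqxx andbT.
by apply/imset2P; exists s 1; rewrite ?conjg1.
Qed.

End Length.

(** * Roots, reflections and descents in type D *)

Section TypeD.
Variable n : nat.
Implicit Types (x y z : signed n) (k : 'I_n) (g v : {perm signed n}).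

Definition neg x : signed n := (x.1, ~~ x.2).

Lemma negK : involutive neg.
Proof. by case=> i b; rewrite /neg /= negbK. Qed.

Lemma neg_inj : injective neg.
Proof. exact: inv_inj negK. Qed.

Lemma eq_fstP x y : reflect (x = y \/ x = neg y) (x.1 == y.1).
Proof.
apply: (iffP eqP) => [|[]->//].
by case: x y => i b [j c] /= ->; case: b c => [] []; [left|right|right|left].
Qed.

(* The pairing of the basis vector [x] with a dominant coweight, so that the
   root [x - y] is positive iff [height y < height x]. *)
Definition height x : int :=
  (if x.2 then - (n.-1 - x.1)%N%:Z else (n.-1 - x.1)%N%:Z)%R.

Lemma height_neg x : height (neg x) = (- height x)%R.
Proof. by case: x => i []; rewrite /height //= opprK. Qed.

Lemma height_neq x y : x.1 != y.1 -> height x != height y.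
Proof.
apply: contraNneq; rewrite /height -val_eqE /=; case: x y => [i b] [j c] /=.
have := ltn_ord i; have := ltn_ord j; case: b; case: c; lia.
Qed.

Definition pair_refl x y : {perm signed n} := tperm x y * tperm (neg x) (neg y).

Lemma pair_refl_out x y z : z != x -> z != y -> z != neg x -> z != neg y ->
  pair_refl x y z = z.
Proof. by move=> *; rewrite permM !tpermD // eq_sym. Qed.

Lemma pair_reflL x y : x.1 != y.1 -> pair_refl x y x = y.
Proof.
move/eq_fstP => ne; rewrite permM tpermL tpermD //; apply/eqP => e; apply: ne.
  by right; rewrite -e negK.
by case: y e => i [] /(congr1 snd).
Qed.

Lemma pair_refl_sym x y : pair_refl x y = pair_refl y x.
Proof. by rewrite /pair_refl tpermC (tpermC (neg x)). Qed.

Lemma pair_refl_neg x y : x.1 != y.1 -> pair_refl (neg x) (neg y) = pair_refl x y.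
Proof.
move=> ne; rewrite /pair_refl !negK [LHS]conjgC; congr (_ * _).
rewrite tpermJ !tpermD //; apply/eqP => e.
all: first [by case: {ne} x e => i [] /(congr1 snd)
           | by case: {ne} y e => i [] /(congr1 snd) | idtac].
all: by case/eq_fstP: ne; right; rewrite -?e ?negK // e negK.
Qed.

Definition signed_perm g : Prop := forall x, g (neg x) = neg (g x).

Lemma pair_refl_signed x y : x.1 != y.1 -> signed_perm (pair_refl x y).
Proof.
move=> ne z.
have ney : y.1 != x.1 by rewrite eq_sym.
have L u w : u.1 != w.1 -> pair_refl u w (neg u) = neg w.
  by move=> h; rewrite -pair_refl_neg // pair_reflL.
have [->|zx] := eqVneq z x; first by rewrite L // pair_reflL.
have [->|zy] := eqVneq z y; first by rewrite pair_refl_sym L // pair_reflL.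
have [->|zx'] := eqVneq z (neg x); first by rewrite L // !negK pair_reflL.
have [->|zy'] := eqVneq z (neg y); first by rewrite pair_refl_sym L // !negK pair_reflL.
have neg_eq w : (neg z == w) = (z == neg w) by rewrite -{1}(negK w) (inj_eq neg_inj).
by rewrite !pair_refl_out // neg_eq ?negK.
Qed.

Lemma pair_reflJ g x y : signed_perm g -> pair_refl x y ^ g = pair_refl (g x) (g y).
Proof. by move=> sg; rewrite /pair_refl conjMg !tpermJ !sg. Qed.

Lemma pair_refl_inv x y : x.1 != y.1 -> (pair_refl x y)^-1 = pair_refl x y.
Proof.
move=> ne; rewrite -[RHS]pair_refl_neg // /pair_refl !negK invMg !tpermV //.
Qed.

Lemma signed_perm_fst g x y : signed_perm g -> ((g x).1 == (g y).1) = (x.1 == y.1).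
Proof.
move=> sg; apply/eq_fstP/eq_fstP; rewrite -?sg => - [e|e].
- by left; apply: perm_inj e.
- by right; apply: perm_inj e.
- by left; rewrite e.
- by right; rewrite e.
Qed.

Definition rootL k : signed n := if (k.+1 < n)%N then (k, false) else (ord_pred k, false).
Definition rootR k : signed n := if (k.+1 < n)%N then (ordS k, false) else (k, true).

Lemma simpleE k : simple k = pair_refl (rootL k) (rootR k).
Proof. by rewrite /simple /rootL /rootR; case: ifP. Qed.

Hypothesis n_gt1 : (1 < n)%N.

Lemma ordS_lt k : (k.+1 < n)%N -> ordS k = k.+1 :> nat.
Proof. exact: modn_small. Qed.

Lemma ord_pred_last k : (k.+1 < n)%N = false -> ord_pred k = n.-2 :> nat.
Proof.
move=> h; have kn := ltn_ord k.
have -> : ord_pred k = (k + n).-1 %% n :> nat by [].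
have -> : ((k + n).-1 = n.-2 + n)%N by lia.
by rewrite modnDr modn_small //; lia.
Qed.

Lemma rootL_height k : height (rootL k) = (height (rootR k) + 1)%R.
Proof.
have kn := ltn_ord k; rewrite /rootL /rootR /height; case h: (k.+1 < n)%N.
  by have /= := ordS_lt h; lia.
by have /= := ord_pred_last h; lia.
Qed.

Lemma rootR_height k : (0 <= height (rootR k))%R.
Proof.
by have kn := ltn_ord k; rewrite /rootR /height; case h: (k.+1 < n)%N => /=; lia.
Qed.

Lemma root_neq k : (rootL k).1 != (rootR k).1.
Proof.
have kn := ltn_ord k; rewrite /rootL /rootR -val_eqE; case h: (k.+1 < n)%N.
  by have /= := ordS_lt h; lia.
by have /= := ord_pred_last h; lia.
Qed.

Lemma simple_signed k : signed_perm (simple k).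
Proof. by rewrite simpleE; apply: pair_refl_signed (root_neq k). Qed.

Lemma simpleV k : (simple k)^-1 = simple k.
Proof. by rewrite simpleE pair_refl_inv ?root_neq. Qed.

Lemma simple2 k : simple k * simple k = 1.
Proof. by rewrite -{1}simpleV mulVg. Qed.

Lemma simpleL k : simple k (rootL k) = rootR k.
Proof. by rewrite simpleE pair_reflL ?root_neq. Qed.

Lemma simpleR k : simple k (rootR k) = rootL k.
Proof. by rewrite simpleE pair_refl_sym pair_reflL // eq_sym root_neq. Qed.

Lemma simple_out k z : z.1 != (rootL k).1 -> z.1 != (rootR k).1 -> simple k z = z.
Proof.
move=> h1 h2; rewrite simpleE pair_refl_out //.
- by apply: contraNneq h1 => ->.
- by apply: contraNneq h2 => ->.
- by apply: contraNneq h1 => ->.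
- by apply: contraNneq h2 => ->.
Qed.

Variant simple_spec k : signed n -> signed n -> Prop :=
| SimpleL : simple_spec k (rootL k) (rootR k)
| SimpleR : simple_spec k (rootR k) (rootL k)
| SimpleNL : simple_spec k (neg (rootL k)) (neg (rootR k))
| SimpleNR : simple_spec k (neg (rootR k)) (neg (rootL k))
| SimpleOut z : simple_spec k z z.

Lemma simpleP k z : simple_spec k z (simple k z).
Proof.
have [/eq_fstP[]->|h1] := boolP (z.1 == (rootL k).1).
- by rewrite simpleL; constructor.
- by rewrite simple_signed simpleL; constructor.
have [/eq_fstP[]->|h2] := boolP (z.1 == (rootR k).1).
- by rewrite simpleR; constructor.
- by rewrite simple_signed simpleR; constructor.
by rewrite simple_out //; constructor.
Qed.

(** A simple reflection shifts heights by at most one, so it can reverse only two adjacent vectors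
    that it exchanges. Nonnegativity of [height (rootR k)] rules out pairs of mixed sign. *)
Lemma simple_inversion k x y : x.1 != y.1 -> (height y < height x)%R ->
  (height (simple k x) < height (simple k y))%R -> pair_refl x y = simple k.
Proof.
have a_ge0 := rootR_height k; have eL := rootL_height k.
case: (simpleP k x) => [||||x']; case: (simpleP k y) => [||||y'] //;
  rewrite ?height_neg ?eqxx //=; try lia.
  by move=> *; rewrite simpleE.
by move=> *; rewrite simpleE pair_refl_sym pair_refl_neg ?root_neq.
Qed.

(* Stated for all positive roots [x - y], because removing the last letter of
   [v] does not keep a simple root simple. *)
Lemma deletion l v x y : v \in simples n ^+ l -> x.1 != y.1 ->
  (height y < height x)%R -> (height (v^-1%g x) < height (v^-1%g y))%R ->
  exists2 m, l = m.+1 & v * pair_refl x y \in simples n ^+ m.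
Proof.
elim: l v x y => [|l IHl] v x y.
  by rewrite expg0 => /set1P->; rewrite invg1 !perm1; lia.
rewrite expgSr => /mulsgP[u s Su /imsetP[k _ ->] ->] ne lt_yx.
rewrite invMg simpleV !permM => lt_xy; exists l => //.
have ne' : (simple k x).1 != (simple k y).1.
  by rewrite signed_perm_fst //; apply: simple_signed.
(* If [simple k] keeps the root positive, a letter of [u] is deleted and the reflection conjugated
   past [simple k]. Otherwise the reflection is [simple k] and cancels the last letter. *)
have [lt'|le'] := boolP (height (simple k y) < height (simple k x))%R.
  have [m -> Sm] := IHl _ _ _ Su ne' lt' lt_xy.
  rewrite -mulgA (conjgCV (simple k)) simpleV pair_reflJ; last exact: simple_signed.
  rewrite mulgA expgSr mem_mulg //; exact: imset_f.
rewrite (@simple_inversion k) //; last by have := height_neq ne'; lia.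
by rewrite -mulgA simple2 mulg1.
Qed.

Lemma gen_signed v : v \in <<simples n>> -> signed_perm v.
Proof.
move/wlength_word; move: (wlength _ v) => l; elim: l v => [|l IHl] v.
  by rewrite expg0 => /set1P-> x; rewrite !perm1.
rewrite expgSr => /mulsgP[u s Su /imsetP[k _ ->] ->] x.
by rewrite !permM (IHl u) // simple_signed.
Qed.

Lemma simple_gen k : simple k \in <<simples n>>.
Proof. by rewrite mem_gen // imset_f. Qed.

Lemma simple_descent v k : v \in <<simples n>> ->
  (height (v^-1%g (rootL k)) < height (v^-1%g (rootR k)))%R ->
  (wlength (simples n) (v * simple k) < wlength (simples n) v)%N.
Proof.
move=> Sv lt; have := rootL_height k => eL.
have [|m -> Sm] := deletion (wlength_word Sv) (root_neq k) _ lt; first by lia.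
by rewrite ltnS wlength_min // simpleE.
Qed.

Lemma weyl_lt_simple v k : v \in <<simples n>> ->
  weyl_lt v (v * simple k) = (height (v^-1%g (rootR k)) < height (v^-1%g (rootL k)))%R.
Proof.
move=> Sv; rewrite /weyl_lt bruhat_lt_simple ?imset_f //.
have ne : height (v^-1%g (rootL k)) != height (v^-1%g (rootR k)).
  rewrite height_neq // signed_perm_fst ?root_neq //.
  by apply: gen_signed; rewrite groupV.
have [lt|ge] := boolP (height (v^-1%g (rootR k)) < height (v^-1%g (rootL k)))%R.
  have := @simple_descent (v * simple k) k; rewrite -mulgA simple2 mulg1.
  apply; first by rewrite groupM ?simple_gen.
  by rewrite invMg simpleV !permM simpleL simpleR.
apply/negbTE; rewrite -leqNgt ltnW // simple_descent //; lia.
Qed.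

End TypeD.

(** * Diagrams and wires *)

Lemma staircaseP n (b : box n) :
  reflect ([/\ 0 < row b, 0 < col b & row b + col b <= n]%N) (b \in staircase n).
Proof. by rewrite inE; apply: and3P. Qed.

Lemma box_at n r c : (0 < r)%N -> (0 < c)%N -> (r + c <= n)%N ->
  exists2 b : box n, b \in staircase n & row b = r /\ col b = c.
Proof.
move=> r0 c0 h; have hr : (r < n)%N by lia.
have hc : (c < n)%N by lia.
by exists (Ordinal hr, Ordinal hc) => //; apply/staircaseP; split.
Qed.

Lemma box_eq n (x y : box n) : row x = row y -> col x = col y -> x = y.
Proof. by case: x y => [a b] [c d] /= h1 h2; congr (_, _); apply: val_inj. Qed.

Lemma box_leI n (x y : box n) : x \in staircase n -> y \in staircase n ->
  (row y <= row x)%N -> (col x <= col y)%N -> box_le x y.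
Proof.
move: {2}((row x - row y) + (col y - col x))%N (leqnn (row x - row y + (col y - col x))).
move=> k; elim: k x => [|k IHk] x hk xS yS hr hc.
  by rewrite (@box_eq _ x y); [exact: connect0 | lia | lia].
have /staircaseP[rx cx nx] := xS; have /staircaseP[ry cy ny] := yS.
have [h|h] : (row y < row x)%N \/ row y = row x by lia.
  have [|//||z zS [rz cz]] := @box_at n (row x).-1 (col x); [lia | lia |].
  apply: (@connect_trans _ _ z); last by apply: IHk => //; lia.
  by apply: connect1; apply/and3P; split=> //; lia.
have [e|h'] : col x = col y \/ (col x < col y)%N by lia.
  by rewrite (@box_eq _ x y); [exact: connect0 | lia | lia].
have [||z zS [rz cz]] := @box_at n (row x) (col x).+1 rx; [lia | lia |].
apply: (@connect_trans _ _ z); last by apply: IHk => //; lia.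
by apply: connect1; apply/and3P; split=> //; lia.
Qed.

(** Both diagonal labels act on the last two coordinates; the sign of the second alternates with the
    column, whence the change of sign of a reentering wire. *)
Lemma label_roots n (b : box n) : (1 < n)%N -> b \in staircase n ->
  let k := Ordinal (label_index_lt b) in
  [/\ (rootL k).1 = (row b + col b - 2)%N :> nat, (rootL k).2 = false,
      (rootR k).1 = (row b + col b - 1)%N :> nat
    & (rootR k).2 = (row b + col b == n)%N && odd (col b)].
Proof.
move=> n1 /staircaseP[r0 c0 rc] k.
have ek : k = label_index b :> nat by [].
have [h|h] : (row b + col b < n)%N \/ (row b + col b = n)%N by lia.
  have ek' : k = (row b + col b - 2)%N :> nat by rewrite ek /label_index h.
  have hk : (k.+1 < n)%N by rewrite ek'; lia.
  rewrite /rootL /rootR hk /= (ltn_eqF h); split=> //.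
  by rewrite [LHS](ordS_lt hk) ek'; lia.
have -> : row b + col b = n by [].
have lb : label_index b = if odd (col b) then (n - 1)%N else (n - 2)%N.
  rewrite /label_index; have -> : (row b + col b < n)%N = false by lia.
  by have -> : (n - row b = col b)%N by lia.
rewrite eqxx /=; case: (odd (col b)) lb => lb.
  have hk : (k.+1 < n)%N = false by rewrite ek lb; lia.
  rewrite /rootL /rootR hk /=; split=> //.
  by rewrite [LHS](ord_pred_last n1 hk); lia.
have hk : (k.+1 < n)%N by rewrite ek lb; lia.
rewrite /rootL /rootR hk; split=> //.
by rewrite [LHS](ordS_lt hk) ek lb; lia.
Qed.

Definition is_zero (a : entry) : bool := if a is Zero then true else false.

(** * The conditions in coordinates *)

Section Diagram.
Variables (n : nat) (O : {set box n}) (D : diagram O).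
Hypothesis idO : order_ideal O.
Implicit Types (b x y z : cells O) (p q : seq (cells O)).

Local Notation rowc b := (row (val b)).
Local Notation colc b := (col (val b)).

Lemma cell_range b : [/\ 0 < rowc b, 0 < colc b & rowc b + colc b <= n]%N.
Proof. by apply/staircaseP; have [/subsetP h _] := idO; apply/h/valP. Qed.

Lemma cell_eq x y : rowc x = rowc y -> colc x = colc y -> x = y.
Proof. by move=> h1 h2; apply/val_inj/box_eq. Qed.

Lemma cell_le x y : (rowc y <= rowc x)%N -> (colc x <= colc y)%N ->
  box_le (val x) (val y).
Proof.
by move=> h1 h2; apply: box_leI => //; have [/subsetP h _] := idO; apply/h/valP.
Qed.

Lemma cell_at z r c : (rowc z <= r)%N -> (0 < c <= colc z)%N -> (r + c <= n)%N ->
  exists2 b : cells O, rowc b = r & colc b = c.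
Proof.
move=> h1 h2 h3; have [r0 c0 rc] := cell_range z.
have [||//|b bS [rb cb]] := @box_at n r c; [lia | lia |].
have Ob : b \in O.
  have [/subsetP h H] := idO; apply: (H b (val z)); first exact: valP.
  by apply: box_leI => //; [apply/h/valP | rewrite rb | rewrite cb; case/andP: h2].
by exists (Sub b Ob).
Qed.

(* Boxes outside the shape count as pluses: they contribute the identity, and
   the Gamma condition holds at them automatically. *)
Definition plus (r c : nat) : bool :=
  ~~ [exists b : cells O, [&& rowc b == r, colc b == c & is_zero (D b)]].

Lemma plusF r c : plus r c = false ->
  exists b : cells O, [/\ rowc b = r, colc b = c & D b = Zero].
Proof.
move/negbFE/existsP => [b /and3P[/eqP ? /eqP ? Db]]; exists b; split=> //.
by case: (D b) Db.
Qed.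

Lemma plus_cell b : plus (rowc b) (colc b) = ~~ is_zero (D b).
Proof.
congr negb; apply/existsP/idP => [[x /and3P[/eqP e1 /eqP e2 Dx]]|Db].
  by rewrite -(cell_eq e1 e2).
by exists b; rewrite !eqxx.
Qed.

Lemma plus_Plus b : plus (rowc b) (colc b) -> D b = Plus.
Proof. by rewrite plus_cell; case: (D b). Qed.

Lemma Plus_plus b : D b = Plus -> plus (rowc b) (colc b).
Proof. by rewrite plus_cell => ->. Qed.

Lemma Zero_plus b : D b = Zero -> plus (rowc b) (colc b) = false.
Proof. by rewrite plus_cell => ->. Qed.

(** All boxes involved lie weakly southwest of the zero box, hence in the order ideal, where [plus]
    and [D] agree. The same holds for the other two conditions. *)
Lemma condition1E : cond1 n plus <-> condition1 D.
Proof.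
split=> [H z Dz [b Db [e lt]] y [ey lty]|H r c r2 c' r0].
  have [yr yc yn] := cell_range y; have [_ _ bn] := cell_range b.
  have e1 : colc z = colc b := e; have e2 : rowc y = rowc z := ey.
  have l1 : (rowc z < rowc b)%N := lt; have l2 : (colc y < colc z)%N := lty.
  case Dy: (D y) => //; have := Plus_plus Dy.
  rewrite e2 (H (rowc z) (colc z) (rowc b)) //.
  - by lia.
  - exact: Zero_plus.
  - by lia.
  - by rewrite e1; apply: Plus_plus.
  - by lia.
move=> /plusF[z [<- <- Dz]] hr hn pb hc'.
have [||//|b rb cb] := @cell_at z r2 (colc z); [lia | have := cell_range z; lia |].
have [|||y ry cy] := @cell_at z (rowc z) c'; [lia | lia | lia |].
rewrite -ry -cy; apply: Zero_plus; apply: (H z Dz).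
  by exists b; [apply: plus_Plus; rewrite rb cb | by split; rewrite ?rb ?cb].
by split; rewrite ?ry ?cy //; case/andP: hc'.
Qed.

Lemma condition2E : cond2 n plus <-> condition2 D.
Proof.
split=> [H z b Dz Db [e lt] [x [Dx [lt1 lt2] ex]]|H].
  have [zr zc zn] := cell_range z; have [xr xc xn] := cell_range x.
  have [br bc bn] := cell_range b.
  have := H (rowc z) (colc z) (colc b) (colc x) zr zn (Zero_plus Dz).
  have -> : rowc z = rowc b by [].
  have -> : (n.+1 - colc z = rowc x)%N.
    by move: ex; rewrite /rows_south /diag_dist; lia.
  rewrite (Plus_plus Db) (Plus_plus Dx) => h.
  have : true = false by apply: h => //; lia.
  by [].
move=> r c c' c2 r0 hn /plusF[z [rz cz Dz]] hc' pb hc2.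
subst r c; apply/negbTE/negP => px.
have [||//|b rb cb] := @cell_at z (rowc z) c'; [lia | lia | lia |].
have [|||x rx cx] := @cell_at z (n.+1 - colc z)%N c2; [lia | lia | lia |].
apply: (H z b Dz); first by apply: plus_Plus; rewrite rb cb.
  by split; rewrite ?rb ?cb //; lia.
exists x; split; first by apply: plus_Plus; rewrite rx cx.
  by split; rewrite ?rx ?cx ?rb ?cb; lia.
by rewrite /rows_south /diag_dist rx; lia.
Qed.

Lemma condition3E : cond3 n plus <-> condition3 D.
Proof.
split=> [H [c [b1 [b2 [b3]]]]|H].
  case=> [[Dc D1 D2 D3] _ [e lt] [ec er] [[ltr ltc] lts]].
  have [cr cc cn] := cell_range c; have [r1 c1 n1] := cell_range b1.
  have [r2 c2 n2] := cell_range b2; have [r3 c3 n3] := cell_range b3.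
  move: er lts; rewrite /strictly_south /rows_south /diag_dist => er lts.
  have e2 : (n.+1 - colc c = rowc b2)%N by lia.
  have : plus (rowc b3) (colc b3) = false; last by rewrite Plus_plus.
  apply: (H (rowc c) (colc c) (colc b1)) => //; try lia.
  - exact: Zero_plus.
  - by rewrite -e Plus_plus.
  - by rewrite e2 -ec Plus_plus.
move=> r c c1 r3 c3 r0 hn /plusF[z [rz cz Dz]] hc1 p1 p2 hr3 hc3.
subst r c; apply/negbTE/negP => p3; apply: H.
have [||//|b1 rb1 cb1] := @cell_at z (rowc z) c1; [lia | lia | lia |].
have [|||b2 rb2 cb2] := @cell_at z (n.+1 - colc z)%N c1; [lia | lia | lia |].
have [|||b3 rb3 cb3] := @cell_at z r3 c3; [lia | lia | lia |].
exists z, b1, b2, b3; split.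
- by split=> //; apply: plus_Plus; rewrite ?rb1 ?rb2 ?rb3 ?cb1 ?cb2 ?cb3.
- by split=> e; move: rb1 rb2 rb3 cb1 cb2 cb3; rewrite -?e; rewrite ?e; lia.
- by split; rewrite ?rb1 ?cb1 //; lia.
- split; rewrite /rows_south /diag_dist ?cb1 ?cb2 //.
  by rewrite rb2 rb1; lia.
- by rewrite /strictly_northwest /strictly_south; lia.
Qed.

(** * Traversal of the boxes from above and from the right *)

Definition visited p (r c : nat) : bool :=
  ~~ [exists b : cells O, [&& rowc b == r, colc b == c & b \notin p]].

Lemma visitedF p r c : visited p r c = false ->
  exists b : cells O, [/\ rowc b = r, colc b = c & b \notin p].
Proof. by move/negbFE/existsP => [b /and3P[/eqP ? /eqP ? ?]]; exists b. Qed.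

Lemma visited_cell p b : visited p (rowc b) (colc b) = (b \in p).
Proof.
rewrite -[RHS]negbK; congr negb; apply/existsP/idP => [[x /and3P[/eqP e1 /eqP e2]]|nb].
  by rewrite (cell_eq e1 e2).
by exists b; rewrite !eqxx.
Qed.

Definition up_closed p : Prop :=
  forall x y, x \in p -> box_le (val x) (val y) -> y \in p.

Lemma visited_up p r c r' c' : up_closed p -> visited p r c -> (r' <= r)%N ->
  (0 < c <= c')%N -> (r + c <= n)%N -> visited p r' c'.
Proof.
move=> up d hr hc hn; case nd: (visited p r' c') => //.
have [y [ry cy]] := visitedF nd.
have [||//|x rx cx] := @cell_at y r c; [lia | lia |].
by rewrite (up x) //; [rewrite -visited_cell rx cx | apply: cell_le; lia].
Qed.

Lemma visited_before p b r c :
  (forall y, box_le (val b) (val y) -> y != b -> y \in p) ->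
  (r <= rowc b)%N -> (colc b <= c)%N -> (r != rowc b) || (c != colc b) -> visited p r c.
Proof.
move=> avail hr hc ne; apply: contraT => /negbTE/visitedF[y [ry cy]].
rewrite avail //; first by apply: cell_le; lia.
by apply/eqP => e; move: ne; rewrite -ry -cy e !eqxx.
Qed.

Lemma visited_inputs p b :
  (forall y, box_le (val b) (val y) -> y != b -> y \in p) ->
  [/\ visited p (rowc b).-1 (colc b), visited p (rowc b) (colc b).+1
    & visited p (rowc b).-1 (colc b).+1].
Proof.
move=> avail; have [r0 _ _] := cell_range b.
by split; apply: (visited_before avail); lia.
Qed.

Lemma visited_not_sw p b r c : up_closed p -> b \notin p -> visited p r c ->
  (0 < c)%N -> (r + c <= n)%N -> ~ ((rowc b <= r)%N /\ (c <= colc b)%N).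
Proof.
move=> up bp d c0 hn [hr hc]; move: bp; rewrite -visited_cell.
by rewrite (visited_up up d) // c0.
Qed.

(* The wires entering [a] from visited boxes are not at the two positions that
   are exchanged at the next box [b]. *)
Lemma frontier_disjoint p a b : up_closed p -> a \notin p -> b \notin p -> a != b ->
  (forall y, box_le (val b) (val y) -> y != b -> y \in p) ->
  let k := (rowc a + colc a)%N in let m := (rowc b + colc b)%N in
  [/\ visited p (rowc a).-1 (colc a) ->
        (k - 2 <> m - 2)%N /\ (k - 2 <> m - 1)%N,
      (k < n)%N -> visited p (rowc a) (colc a).+1 ->
        (k - 1 <> m - 2)%N /\ (k - 1 <> m - 1)%N
    & k = n -> visited p (rowc a).-1 (colc a).+1 ->
        (k - 1 <> m - 2)%N /\ (k - 1 <> m - 1)%N].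
Proof.
move=> up ap bp ab avail k m; rewrite {}/k {}/m.
have [v1 v2 _] := visited_inputs avail.
have nw1 := visited_not_sw up ap v1; have nw2 := visited_not_sw up ap v2.
have sw r c (d : visited p r c) := visited_not_sw up bp d.
have nab : rowc a <> rowc b \/ colc a <> colc b.
  have [e|] := eqVneq (rowc a) (rowc b); last by left; apply/eqP.
  by right=> e'; case/eqP: ab; apply: cell_eq.
have := cell_range a; have := cell_range b.
move: nw1 nw2 sw nab {ab v1 v2 avail}.
move: (rowc a) (colc a) (rowc b) (colc b) => ra ca rb cb nw1 nw2 sw nab.
move=> [rb0 cb0 hb] [ra0 ca0 ha]; split=> [|lt|eq] /sw{sw}; lia.
Qed.

Lemma visited_rcons p b r c : visited (rcons p b) r c ->
  visited p r c \/ r = rowc b /\ c = colc b.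
Proof.
case dp: (visited p r c); first by left.
have [x [<- <- xp]] := visitedF dp; rewrite visited_cell mem_rcons inE (negbTE xp) orbF.
by move/eqP->; right.
Qed.

(** Outside the shape all boxes are pluses, so the values depend only on [r + c]. They vanish on the
    diagonal, where the change of sign is harmless. *)
Lemma vert_free r c : (0 < c)%N -> (r + c <= n)%N -> visited [::] r c ->
  vert n plus r c = (n%:Z - r%:Z - c%:Z)%R.
Proof.
have up : up_closed [::] by [].
elim: r c => [|r IHr] c c0 hn dc; first by rewrite /= subr0.
have dc1 : visited [::] r c.+1.
  have [r0|r0] : r = 0%N \/ (0 < r)%N by lia.
    apply/negP => /existsP[b /and3P[/eqP rb _ _]]; have [] := cell_range b; lia.
  by apply: visited_up dc _ _ _ => //; lia.
have free d : visited [::] r.+1 d -> plus r.+1 d.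
  apply: contraTT => /negbTE/plusF[b [<- <- _]]; by rewrite visited_cell.
rewrite vertE // free //.
have [e|lt] : (r.+1 + c)%N = n \/ (r.+1 + c < n)%N by lia.
  by rewrite horiz_diag //= IHr //; lia.
rewrite horizE // free /=; last by apply: visited_up dc _ _ _ => //; lia.
by rewrite IHr //; lia.
Qed.

Hypothesis n_gt1 : (1 < n)%N.

Definition boxL b := rootL (Ordinal (label_index_lt (val b))).
Definition boxR b := rootR (Ordinal (label_index_lt (val b))).

Lemma box_rootsP b :
  [/\ (boxL b).1 = (rowc b + colc b - 2)%N :> nat, (boxL b).2 = false,
      (boxR b).1 = (rowc b + colc b - 1)%N :> nat
    & (boxR b).2 = (rowc b + colc b == n)%N && odd (colc b)].
Proof. by apply: label_roots => //; have [/subsetP h _] := idO; apply/h/valP. Qed.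

Lemma signed_eq (x y : signed n) : x.1 = y.1 :> nat -> x.2 = y.2 -> x = y.
Proof. by case: x y => [i a] [j b] /= h ->; congr (_, _); apply: val_inj. Qed.

(* [visited p] marks the boxes already traversed, those outside the shape
   included: the wires entering an untraversed box from traversed ones carry
   the values [vert] (from above) and [horiz] (from the right, or, at the
   diagonal, from the diagonal box of the previous row). *)
Definition wires_at p (v : {perm signed n}) : Prop :=
  forall b, b \notin p ->
    (visited p (rowc b).-1 (colc b) ->
        height (v^-1 (boxL b)) = vert n plus (rowc b).-1 (colc b))
    /\ (visited p (if (rowc b + colc b < n)%N then rowc b else (rowc b).-1) (colc b).+1 ->
        height (v^-1 (boxR b)) = horiz n plus (rowc b) (colc b)).

Lemma wires_nil : wires_at [::] 1.
Proof.
move=> b _; have [r0 c0 hn] := cell_range b; have [L1 L2 R1 R2] := box_rootsP b.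
rewrite invg1 !perm1 /height L1 L2; split=> [d|].
  by rewrite vert_free //; lia.
case: ifP => h d.
  have plus_next : plus (rowc b) (colc b).+1.
    by apply: contraTT d => /negbTE/plusF[x [<- <- _]]; rewrite visited_cell.
  rewrite horizE // plus_next vert_free; [|lia|lia|].
    by rewrite R2 R1 (ltn_eqF h) andFb; lia.
  by apply: visited_up d _ _ _ => //; lia.
rewrite horiz_diag //; last by lia.
rewrite vert_free // ?R1; last by lia.
by case: ifP; lia.
Qed.

Lemma wires_rcons p b (v : {perm signed n}) : up_closed p -> b \notin p ->
  (forall y, box_le (val b) (val y) -> y != b -> y \in p) ->
  v \in <<simples n>> -> wires_at p v ->
  wires_at (rcons p b) (v * (if D b is Zero then box_refl (val b) else 1)).
Proof.
move=> up bp avail vS W.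
have [r0 c0 hn] := cell_range b; have [L1 L2 R1 R2] := box_rootsP b.
have sv : signed_perm v^-1 by apply: gen_signed => //; rewrite groupV.
have [v1 v2 v3] := visited_inputs avail.
have [Wv Wh] := W b bp; have {v1}Wv := Wv v1.
have {v2 v3}Wh : height (v^-1 (boxR b)) = horiz n plus (rowc b) (colc b).
  by apply: Wh; case: ifP.
set t : {perm signed n} := if D b is Zero then box_refl (val b) else 1.
have vt (x : signed n) : (v * t)^-1 x =
    v^-1 (if is_zero (D b) then simple (Ordinal (label_index_lt (val b))) x else x).
  rewrite invMg permM; congr (v^-1 _); rewrite /t /box_refl.
  by case: (D b) => /=; rewrite ?simpleV // invg1 perm1.
have out (x : signed n) : x.1 <> (rowc b + colc b - 2)%N :> nat ->
    x.1 <> (rowc b + colc b - 1)%N :> nat -> (v * t)^-1 x = v^-1 x.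
  move=> h1 h2; rewrite vt; case: ifP => // _; rewrite simple_out //.
    by apply: contra_not_neq h1 => ->; apply: L1.
  by apply: contra_not_neq h2 => ->; apply: R1.
have outL : height ((v * t)^-1 (boxL b)) =
    if plus (rowc b) (colc b) then vert n plus (rowc b).-1 (colc b)
    else horiz n plus (rowc b) (colc b).
  by rewrite vt plus_cell; case: (is_zero _) => //=; rewrite simpleL.
have outR : height ((v * t)^-1 (boxR b)) = vert n plus (rowc b) (colc b).
  by rewrite vt vertE // plus_cell; case: (is_zero _) => //=; rewrite simpleR.
move=> a; rewrite mem_rcons inE negb_or => /andP[ab ap].
have [ra ca ha] := cell_range a; have [L1a L2a R1a R2a] := box_rootsP a.
have [F1 F2 F3] := frontier_disjoint up ap bp ab avail.
have [Wva Wha] := W a ap.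
split.
  case/visited_rcons => [d|[e1 e2]].
    have [h1 h2] := F1 d.
    by rewrite out ?Wva ?L1a.
  have e3 : (rowc a + colc a = (rowc b + colc b).+1)%N.
    by rewrite -e1 -e2 -addSn prednK.
  have -> : boxL a = boxR b.
    apply: signed_eq; first by rewrite L1a R1 e3 subSS.
    by rewrite L2a R2 ltn_eqF // -e3.
  by rewrite outR e1 e2.
case: ifP Wha => h Wha.
  case/visited_rcons => [d|[e1 e2]].
    have [h1 h2] := F2 h d.
    by rewrite out ?Wha ?R1a.
  have -> : boxR a = boxL b.
    apply: signed_eq; first by rewrite R1a L1 -e1 -e2 addnS subSS.
    by rewrite R2a L2 (ltn_eqF h).
  by rewrite outL [RHS]horizE // e1 e2.
have hd : (rowc a + colc a = n)%N by apply/eqP; rewrite eqn_leq ha leqNgt h.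
case/visited_rcons => [d|[e1 e2]].
  have [h1 h2] := F3 hd d.
  by rewrite out ?Wha ?R1a.
have e3 : (rowc b + colc b = n)%N by rewrite -e1 -e2 addnS -addSn prednK.
(* Here [a] and [b] are consecutive diagonal boxes, so their columns have opposite parity. *)
have -> : boxR a = neg (boxR b).
  apply: signed_eq; first by rewrite R1a R1 hd e3.
  have -> : (neg (boxR b)).2 = ~~ (boxR b).2 by [].
  by rewrite R2a R2 hd e3 eqxx -e2 /= negbK.
have -> : (v * t)^-1 (neg (boxR b)) = neg ((v * t)^-1 (boxR b)).
  by rewrite !vt; case: ifP => _; rewrite -sv // simple_signed.
by rewrite height_neg outR horiz_diag // e1 e2.
Qed.

Lemma partial_product_gen p : partial_product D p \in <<simples n>>.
Proof.
by apply: group_prod => b _; case: (D b); rewrite ?group1 // simple_gen.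
Qed.

(** * The Gamma condition along a linear extension *)

Section Extension.
Variables (e : seq (cells O)) (he : linear_extension e).

Lemma prefix_up p q : rev e = p ++ q -> up_closed p.
Proof.
move=> ee x y xp le_xy; have [ue ae oe] := he.
have e' : e = rev q ++ rev p by rewrite -rev_cat -ee revK.
have xq : x \notin rev q.
  move: ue; rewrite e' cat_uniq => /and3P[_ /hasPn h _].
  by apply: h; rewrite mem_rev.
have := oe x y le_xy; rewrite e' !index_cat (negbTE xq).
case: ifP => yq; first by rewrite -index_mem in yq; lia.
by move=> _; move: (ae y); rewrite e' mem_cat yq mem_rev.
Qed.

Lemma prefix_next p b q : rev e = p ++ b :: q ->
  b \notin p /\ forall y, box_le (val b) (val y) -> y != b -> y \in p.
Proof.
move=> ee; have [ue ae oe] := he; split.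
  by move: ue; rewrite -rev_uniq ee cat_uniq /= negb_or => /and3P[_ /andP[]].
move=> y le_by ne; have := @prefix_up (rcons p b) q; rewrite cat_rcons => /(_ ee b y).
by rewrite mem_rcons inE eqxx => /(_ isT le_by); rewrite mem_rcons inE (negbTE ne).
Qed.

Lemma wires_prefix p q : rev e = p ++ q -> wires_at p (partial_product D p).
Proof.
elim/last_ind: p q => [|p b IHp] q.
  by rewrite /partial_product big_nil => _; apply: wires_nil.
rewrite cat_rcons => ee; have [bp avail] := prefix_next ee.
rewrite /partial_product -cats1 big_cat big_seq1 cats1 -/(partial_product D p).
apply: wires_rcons => //; [exact: prefix_up ee | exact: partial_product_gen | exact: IHp ee].
Qed.

Lemma Gamma_step p b q : rev e = p ++ b :: q ->
  weyl_lt (partial_product D p) (partial_product D p * box_refl (val b))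
  = (horiz n plus (rowc b) (colc b) < vert n plus (rowc b).-1 (colc b))%R.
Proof.
move=> ee; have [bp avail] := prefix_next ee; have [r0 c0 hn] := cell_range b.
have [v1 v2 v3] := visited_inputs avail.
rewrite /box_refl weyl_lt_simple ?partial_product_gen //.
have [Wv Wh] := wires_prefix ee bp.
by rewrite Wv ?Wh //; case: ifP.
Qed.

Lemma Gamma_rows : Gamma_diagram e D <-> forall r, (0 < r < n)%N -> row_ok n plus r.
Proof.
have [ue ae oe] := he; split=> [G r hr c c0 hn|ok p q b ee]; last first.
  rewrite (Gamma_step ee); have [r0 c0 hn] := cell_range b.
  by apply: ok => //; lia.
(* At a box outside the shape the entering values are [n - r - c] from the right and one more from
   above. *)
case dn: (visited [::] r c).
  have up : up_closed [::] by [].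
  rewrite [vert _ _ _ _]vert_free; [|lia|lia|by apply: (visited_up up dn); lia].
  have e1 : vert n plus r c = horiz n plus r c.
    rewrite vertE; last by lia.
    suff -> : plus r c by [].
    by apply: contraTT dn => /negbTE/plusF[b [<- <- _]]; rewrite visited_cell.
  by rewrite -e1 vert_free //; lia.
have [b [<- <- _]] := visitedF dn.
have : b \in rev e by rewrite mem_rev ae.
case/splitPr ee: _ / => [p q].
by rewrite -(Gamma_step ee); apply: G ee.
Qed.

End Extension.

End Diagram.

Theorem mainTheorem8 (n : nat) (hn : 4 <= n) (O : {set box n})
    (hO : order_ideal O) (e : seq (cells O)) (he : linear_extension e)
    (D : diagram O) :
  Gamma_diagram e D <-> [/\ condition1 D, condition2 D & condition3 D].
Proof.
have n1 : (1 < n)%N by lia.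
rewrite (Gamma_rows D hO n1 he) row_ok_conds.
by split=> -[] /(condition1E D hO)? /(condition2E D hO)? /(condition3E D hO)?.
Qed.
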